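(* For every integer $m\ge 1$, the map $$\Psi_m:=\Phi_{2m}^{-1}\circ\Phi_{2m+1}:\mathcal{P}_{\mathrm{pal}}^{\,2m+1}\longrightarrow\mathcal{P}_{\mathrm{pal}}^{\,2m}$$ is a bijection. Explicitly, if $\lambda\in\mathcal{P}_{\mathrm{pal}}^{\,2m+1}$ has smallest part $s$ and gap sequence $$(d_1,\dots,d_m,d_m,\dots,d_1),$$ then $\Psi_m(\lambda)$ is the partition in $\mathcal{P}_{\mathrm{pal}}^{\,2m}$ with smallest part $s$ and gap sequence $$(d_1,\dots,d_{m-1},d_m,d_{m-1},\dots,d_1).$$ In particular, writing $T=s+d_1+\cdots+d_m$, $$|\lambda|=(2m+1)T,\qquad |\Psi_m(\lambda)|=m(2T-d_m).$$
   Context: A partition is a finite sequence $\lambda=(\lambda_1,\dots,\lambda_\ell)$ of positive integers written in non-decreasing order (the empty partition is allowed); $|\lambda|$ is the sum of its parts. Its gap sequence is $(\lambda_2-\lambda_1,\dots,\lambda_\ell-\lambda_{\ell-1})$, and $\lambda$ is a palindromic-gap partition if this sequence is a palindrome. $\mathcal{P}_{\mathrm{pal}}^{\,r}$ denotes the set of palindromic-gap partitions with exactly $r$ parts, and $\mathcal{P}_{\le m+1}$ the set of all partitions with at most $m+1$ parts, including the empty partition. The bijection $\Phi_{2m+1}:\mathcal{P}_{\mathrm{pal}}^{\,2m+1}\to\mathcal{P}_{\le m+1}$ is defined as follows: for $\lambda$ with smallest part $s$ and gap sequence $(d_1,\dots,d_m,d_m,\dots,d_1)$, set $x_0=s-1$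 and $x_i=d_i$ for $1\le i\le m$; let $a_j=x_0+x_1+\cdots+x_{j-1}$ for $1\le j\le m$ and $R=x_0+x_1+\cdots+x_m$; then $\Phi_{2m+1}(\lambda)$ is the partition obtained from the non-decreasing sequence $(a_1,\dots,a_m,R)$ by deleting its zero entries. The bijection $\Phi_{2m}:\mathcal{P}_{\mathrm{pal}}^{\,2m}\to\mathcal{P}_{\le m+1}$ is defined as follows: for $\lambda$ with smallest part $s$ and gap sequence $(d_1,\dots,d_{m-1},e,d_{m-1},\dots,d_1)$, set $x_0=s-1$, $x_i=d_i$ for $1\le i\le m-1$, and $x_m=e$; let $a_j=x_0+x_1+\cdots+x_{j-1}$ for $1\le j\le m$ and $R=x_0+x_1+\cdots+x_m$; then $\Phi_{2m}(\lambda)$ is the partition obtained from the non-decreasing sequence $(a_1,\dots,a_m,R)$ by deleting its zero entries. *)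

(* Defs.v *)
From HB Require Import structures.
From mathcomp Require Import all_boot zify.

Set Implicit Arguments.
Unset Strict Implicit.
Unset Printing Implicit Defensive.

Record partition := Partition {
  parts :> seq nat;
  _ : sorted leq parts && (0 \notin parts) }.

HB.instance Definition _ := [isSub for parts].
HB.instance Definition _ := [Countable of partition by <:].

(* Parts are in non-decreasing order, so the first one is the smallest
   (0 for the empty partition). *)
Definition smallest (l : seq nat) : nat := head 0 l.

(* The subtractions never truncate, the parts being non-decreasing. *)
Definition gaps (l : seq nat) : seq nat :=
  pairmap (fun a b => b - a) (head 0 l) (behead l).

Definition palindromic_gap (l : seq nat) : bool := rev (gaps l) == gaps l.

Record pal_part (r : nat) := PalPart {
  pal_val :> partition;
  _ : palindromic_gap pal_val && (size pal_val == r) }.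

HB.instance Definition _ r := [isSub for @pal_val r].
HB.instance Definition _ r := [Countable of pal_part r by <:].

Record part_le (k : nat) := PartLe {
  le_val :> partition;
  _ : size le_val <= k }.

HB.instance Definition _ k := [isSub for @le_val k].
HB.instance Definition _ k := [Countable of part_le k by <:].

(* x_0 = s - 1 and x_i is the i-th gap.  For i <= m this covers both parities:
   when there are 2m parts the m-th gap is the central gap e. *)
Definition xcoord (l : seq nat) (i : nat) : nat :=
  if i is j.+1 then nth 0 (gaps l) j else (smallest l).-1.

Definition acoord (l : seq nat) (j : nat) : nat := \sum_(i < j) xcoord l i.

Definition Rcoord (m : nat) (l : seq nat) : nat := \sum_(i < m.+1) xcoord l i.

Definition phi_full (m : nat) (l : seq nat) : seq nat :=
  rcons [seq acoord l j | j <- iota 1 m] (Rcoord m l).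

Definition phi (m : nat) (l : seq nat) : seq nat :=
  [seq k <- phi_full m l | 0 < k].

Lemma phi_fullE m l : phi_full m l = [seq acoord l j | j <- iota 1 m.+1].
Proof. by rewrite -[m.+1]addn1 iotaD map_cat /= cats1 add1n. Qed.

Lemma size_phi_full m l : size (phi_full m l) = m.+1.
Proof. by rewrite phi_fullE size_map size_iota. Qed.

Lemma phi_full_sorted m l : sorted leq (phi_full m l).
Proof.
rewrite phi_fullE sorted_map.
apply: (@sub_sorted _ ltn); last exact: iota_ltn_sorted.
move=> i j /= /ltnW ij; rewrite /acoord -!(big_mkord xpredT (xcoord l)).
by rewrite (big_cat_nat _ ij) //= leq_addr.
Qed.

Lemma phi_partition m l : sorted leq (phi m l) && (0 \notin phi m l).
Proof.
by rewrite sorted_filter ?phi_full_sorted ?mem_filter //; exact: leq_trans.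
Qed.

Lemma phi_size m l : size (phi m l) <= m.+1.
Proof. by rewrite size_filter -(size_phi_full m l) count_size. Qed.

Definition phi_part (m : nat) (l : seq nat) : part_le m.+1 :=
  @PartLe m.+1 (Partition (phi_partition m l)) (phi_size m l).

Definition Phi_odd (m : nat) (l : pal_part (2 * m + 1)) : part_le m.+1 :=
  phi_part m l.

Definition Phi_even (m : nat) (l : pal_part (2 * m)) : part_le m.+1 :=
  phi_part m l.

Lemma size_gaps l : size (gaps l) = (size l).-1.
Proof. by rewrite size_pairmap size_behead. Qed.

Lemma gaps_scanl a g : gaps (a :: scanl addn a g) = g.
Proof. by apply: scanlK => x y /=; rewrite addKn. Qed.

Lemma scanl_gaps l : sorted leq l -> 0 < size l ->
  l = smallest l :: scanl addn (smallest l) (gaps l).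
Proof.
case: l => //= a l + _; rewrite /gaps /smallest /=; move=> H; congr cons.
by elim: l a H => //= b l IH a /andP[ab /IH E]; rewrite subnKC // -E.
Qed.

Lemma scanl_partition a g : 0 < a ->
  sorted leq (a :: scanl addn a g) && (0 \notin a :: scanl addn a g).
Proof.
elim: g a => [|b g IH] a a0 /=; first by rewrite inE eq_sym -lt0n a0.
have /= /andP[-> H] := IH (a + b) (ltn_addr _ a0).
by rewrite leq_addr inE negb_or eq_sym -lt0n a0 H.
Qed.

Lemma sorted_zeros (s : seq nat) : sorted leq s ->
  s = nseq (size s - size [seq k <- s | 0 < k]) 0 ++ [seq k <- s | 0 < k].
Proof.
elim: s => //= a s IH H; have {IH}E := IH (path_sorted H).
case: a H => [|a] H /=.
  by rewrite subSn ?size_filter ?count_size //= -size_filter -E.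
have -> : [seq k <- s | 0 < k] = s.
  apply/all_filterP; apply/allP => x xs.
  by have /allP/(_ _ xs) := order_path_min leq_trans H; apply: leq_trans.
by rewrite subnn.
Qed.

Lemma acoordS l j : acoord l j.+1 = acoord l j + xcoord l j.
Proof. by rewrite /acoord big_ord_recr. Qed.

Lemma phi_xcoord_inj m l1 l2 : phi m l1 = phi m l2 ->
  forall i, i <= m -> xcoord l1 i = xcoord l2 i.
Proof.
move=> E i im.
have {}E : phi_full m l1 = phi_full m l2.
  rewrite (sorted_zeros (phi_full_sorted m l1)).
  rewrite (sorted_zeros (phi_full_sorted m l2)).
  by rewrite -!/(phi _ _) E !size_phi_full.
have A j : j <= m.+1 -> acoord l1 j = acoord l2 j.
  case: j => [_|j jm]; first by rewrite /acoord !big_ord0.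
  have := congr1 (nth 0 ^~ j) E; rewrite !phi_fullE.
  by rewrite !(nth_map 0) ?size_iota // nth_iota.
by have := A i.+1 im; rewrite !acoordS (A i (leqW im)) => /addnI.
Qed.

Lemma Phi_even_inj m : 0 < m -> injective (@Phi_even m).
Proof.
move=> m0 l1 l2 /(congr1 (fun p : part_le _ => parts p)) /= E.
have X := phi_xcoord_inj E.
apply: val_inj; apply: val_inj => /=.
case: l1 l2 {E} X => -[l1 /= /andP[s1 n1]] /= /andP[/eqP p1 /eqP z1].
case=> -[l2 /= /andP[s2 n2]] /= /andP[/eqP p2 /eqP z2] X.
have /(scanl_gaps s1) E1 : 0 < size l1 by rewrite z1 muln_gt0.
have /(scanl_gaps s2) E2 : 0 < size l2 by rewrite z2 muln_gt0.
have pos l : 0 \notin l -> size l = 2 * m -> (smallest l).-1.+1 = smallest l.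
  case: l => [|[|a] l] //=.
  by move=> _ H; have : 0 < 2 * m by [rewrite muln_gt0]; rewrite -H.
have S : smallest l1 = smallest l2.
  by rewrite -(pos l1) // -(pos l2) //; congr _.+1; exact: (X 0).
have sz1 : size (gaps l1) = (2 * m).-1 by rewrite size_gaps z1.
have sz2 : size (gaps l2) = (2 * m).-1 by rewrite size_gaps z2.
suff G : gaps l1 = gaps l2 by rewrite E1 E2 S G.
apply: (@eq_from_nth _ 0) => [|i]; first by rewrite sz1.
rewrite sz1 => Hi; case: (ltnP i m) => im; first exact: (X i.+1).
rewrite -p1 -p2 !nth_rev ?sz1 ?sz2 //.
by apply: (X (_ - i.+1).+1); lia.
Qed.

Lemma Phi_even_surj m (m0 : 0 < m) (mu : part_le m.+1) :
  exists l, @Phi_even m l == mu.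
Proof.
case: mu => -[mu /= Hmu] /= zmu; have /andP[smu nmu] := Hmu.
pose y := nseq (m.+1 - size mu) 0 ++ mu.
have zy : size y = m.+1 by rewrite size_cat size_nseq subnK.
have fy : [seq k <- y | 0 < k] = mu.
  rewrite filter_cat filter_nseq /=; apply/all_filterP/allP => x xmu.
  by rewrite lt0n; apply: contraNneq nmu => <-.
have ymono i j : i <= j -> j < m.+1 -> nth 0 y i <= nth 0 y j.
  move=> ij jm; rewrite !nth_cat size_nseq.
  case: ltnP => h1; first by rewrite nth_nseq h1.
  case: ltnP => h2; first by lia.
  by apply: (sorted_leq_nth leq_trans leqnn) => //; rewrite ?inE; lia.
pose x i := nth 0 y i.+1 - nth 0 y i.
pose h := [seq x i | i <- iota 0 m.-1].
pose g := h ++ x m.-1 :: rev h.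
have zh : size h = m.-1 by rewrite size_map size_iota.
pose l := (nth 0 y 0).+1 :: scanl addn (nth 0 y 0).+1 g.
have pl : sorted leq l && (0 \notin l) by exact: scanl_partition.
have gl : gaps l = g by exact: gaps_scanl.
have ql : palindromic_gap (Partition pl) && (size (Partition pl) == 2 * m).
  rewrite /palindromic_gap gl /g rev_cat rev_cons revK cat_rcons eqxx /=.
  by rewrite size_scanl size_cat /= size_rev zh; apply/eqP; lia.
exists (PalPart ql); apply/eqP; do 2!apply: val_inj => /=.
rewrite -fy /phi; congr filter; rewrite phi_fullE.
have X i : i < m -> xcoord l i.+1 = x i.
  move=> im; rewrite /xcoord gl /g nth_cat zh.
  case: ltnP => h1; first by rewrite (nth_map 0) ?size_iota // nth_iota.
  by have -> : i = m.-1 by [lia]; rewrite subnn.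
have A i : i < m.+1 -> acoord l i.+1 = nth 0 y i.
  elim: i => [|i IH] im; first by rewrite /acoord big_ord1.
  by rewrite acoordS IH 1?ltnW // X // subnKC // ymono.
apply: (@eq_from_nth _ 0) => [|i]; rewrite size_map size_iota ?zy // => im.
by rewrite (nth_map 0) ?size_iota // nth_iota // add1n A.
Qed.

Definition Phi_even_inv (m : nat) (m0 : 0 < m) (mu : part_le m.+1) :
  pal_part (2 * m) := xchoose (Phi_even_surj m0 mu).

Lemma Phi_even_invK m (m0 : 0 < m) :
  cancel (Phi_even_inv m0) (@Phi_even m).
Proof. by move=> mu; exact/eqP/(xchooseP (Phi_even_surj m0 mu)). Qed.

Lemma Phi_evenK m (m0 : 0 < m) :
  cancel (@Phi_even m) (Phi_even_inv m0).
Proof. by move=> l; apply: (Phi_even_inj m0); rewrite Phi_even_invK. Qed.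

Definition Psi (m : nat) (m0 : 0 < m) :
  pal_part (2 * m + 1) -> pal_part (2 * m) :=
  Phi_even_inv m0 \o @Phi_odd m.

(* Main.v *)
Require Import Defs.
From mathcomp Require Import all_boot.
From mathcomp Require Import zify.

(** Both maps Phi record only the coordinates x_0, ..., x_m of a partition,
    that is its smallest part and its first m gaps, and they record them by
    the same formula.  So Psi, which satisfies Phi_even (Psi lam) = Phi_odd lam,
    keeps the smallest part and the first m gaps ([Psi_xcoord]).  A palindrome
    of length 2m or 2m - 1 is determined by its first m entries
    ([palindrome_eq]): this gives the explicit form of Psi lam, and also the
    injectivity of Psi.  For surjectivity, given mu with 2m parts, the partition
    whose gaps are the first m gaps of mu followed by their mirror image is a
    preimage ([unpsi], [unpsiK]).

    The sums come from one identity for every palindromic-gap partition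
    ([double_sumn]): the symmetry of the gaps makes the i-th part from the left
    and the i-th part from the right add up to smallest part + largest part,
    whatever i is, so that twice the sum is the number of parts times that
    constant. *)

Set Implicit Arguments.
Unset Strict Implicit.
Unset Printing Implicit Defensive.

Lemma palindrome_eq (T : Type) (x0 : T) (s t : seq T) :
  rev s = s -> rev t = t -> size s = size t ->
  (forall i, i < uphalf (size s) -> nth x0 s i = nth x0 t i) -> s = t.
Proof.
move=> ps pt zst st; apply: (@eq_from_nth _ x0) => // i Hi.
case: (ltnP i (uphalf (size s))) => [/st //|Hh].
rewrite -ps -pt !nth_rev -?zst //.
by apply: st; lia.
Qed.

Section PalPart.
Variable r : nat.
Implicit Type l : pal_part r.

Lemma size_pal l : size l = r.
Proof. by case: l => p /= /andP[_ /eqP]. Qed.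

Lemma rev_gaps l : rev (gaps l) = gaps l.
Proof. by case: l => p /= /andP[/eqP]. Qed.

Lemma size_gaps_pal l : size (gaps l) = r.-1.
Proof. by rewrite size_gaps size_pal. Qed.

Lemma pal_scanl l : 0 < r ->
  l = smallest l :: scanl addn (smallest l) (gaps l) :> seq nat.
Proof.
move=> r0; apply: scanl_gaps; last by rewrite size_pal.
by case: l => -[s /= /andP[]].
Qed.

Lemma smallest_gt0 l : 0 < r -> 0 < smallest l.
Proof.
move=> r0; have : 0 < size l by rewrite size_pal.
case: l => -[[|a s] /andP[_ a0]] //= _ _.
by move: a0; rewrite inE negb_or eq_sym lt0n => /andP[].
Qed.

Lemma pal_part_eq l1 l2 : 0 < r ->
  smallest l1 = smallest l2 -> gaps l1 = gaps l2 -> l1 = l2.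
Proof.
move=> r0 S G; do 2!apply: val_inj => /=.
by rewrite (pal_scanl l1 r0) (pal_scanl l2 r0) S G.
Qed.

Lemma pal_part_of_gaps a g : 0 < r -> 0 < a -> rev g = g -> size g = r.-1 ->
  {l : pal_part r | smallest l = a /\ gaps l = g}.
Proof.
move=> r0 a0 pg zg.
have ql : palindromic_gap (Partition (scanl_partition g a0)) &&
          (size (Partition (scanl_partition g a0)) == r).
  by rewrite /palindromic_gap gaps_scanl pg eqxx /= size_scanl zg prednK.
by exists (PalPart ql); rewrite /= gaps_scanl.
Qed.

End PalPart.

(** Parts are positive, so the truncated subtraction x_0 = s - 1 loses nothing. *)
Lemma xcoord_smallest r1 r2 (l1 : pal_part r1) (l2 : pal_part r2) :
  0 < r1 -> 0 < r2 -> xcoord l1 0 = xcoord l2 0 -> smallest l1 = smallest l2.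
Proof.
move=> r10 r20 /= E.
by rewrite -(prednK (smallest_gt0 l1 r10)) E prednK ?smallest_gt0.
Qed.

Lemma pal_part_xcoord r (l1 l2 : pal_part r) : 0 < r ->
  (forall i, i <= r./2 -> xcoord l1 i = xcoord l2 i) -> l1 = l2.
Proof.
move=> r0 X; apply: pal_part_eq => //; first exact: xcoord_smallest (X 0 _).
apply: (@palindrome_eq _ 0); rewrite ?rev_gaps ?size_gaps_pal // => i Hi.
by apply: (X i.+1); lia.
Qed.

Lemma eq_phi m l1 l2 :
  (forall i, i <= m -> xcoord l1 i = xcoord l2 i) -> phi m l1 = phi m l2.
Proof.
move=> X; rewrite /phi !phi_fullE; congr filter; apply/eq_in_map => j.
rewrite mem_iota => /andP[_ Hj]; apply: eq_bigr => i _; apply: X.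
by have := ltn_ord i; lia.
Qed.

Section Psi.
Variables (m : nat) (m0 : 0 < m).

Let odd_gt0 : 0 < 2 * m + 1. Proof. by rewrite addn1. Qed.
Let even_gt0 : 0 < 2 * m. Proof. by rewrite muln_gt0. Qed.

Lemma Psi_xcoord (lam : pal_part (2 * m + 1)) i : i <= m -> xcoord (Psi m0 lam) i = xcoord lam i.
Proof.
move=> im; apply: (@phi_xcoord_inj m) => //.
by have /(congr1 (fun p : part_le _ => parts p)) := Phi_even_invK m0 (Phi_odd lam).
Qed.

Lemma Psi_inj : injective (Psi m0).
Proof.
move=> l1 l2 E; apply: pal_part_xcoord => // i Hi.
have im : i <= m by lia.
by rewrite -!Psi_xcoord // E.
Qed.

Definition unpsi_gaps (mu : pal_part (2 * m)) : seq nat :=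
  take m (gaps mu) ++ rev (take m (gaps mu)).

Lemma rev_unpsi_gaps mu : rev (unpsi_gaps mu) = unpsi_gaps mu.
Proof. by rewrite rev_cat revK. Qed.

Lemma size_unpsi_gaps mu : size (unpsi_gaps mu) = (2 * m + 1).-1.
Proof. by rewrite size_cat size_rev size_takel ?size_gaps_pal; lia. Qed.

(** The inverse of Psi: it duplicates the central gap. *)
Definition unpsi (mu : pal_part (2 * m)) : pal_part (2 * m + 1) :=
  sval (pal_part_of_gaps odd_gt0 (smallest_gt0 mu even_gt0)
                         (rev_unpsi_gaps mu) (size_unpsi_gaps mu)).

Lemma unpsi_xcoord mu i : i <= m -> xcoord (unpsi mu) i = xcoord mu i.
Proof.
rewrite /unpsi; case: pal_part_of_gaps => l [/= S G].
case: i => [|i] im /=; first by rewrite S.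
by rewrite G nth_cat size_takel ?im ?nth_take // size_gaps_pal; lia.
Qed.

Lemma unpsiK : cancel unpsi (Psi m0).
Proof.
move=> mu; rewrite -[RHS](Phi_evenK m0); congr (Phi_even_inv m0).
by do 2!apply: val_inj => /=; apply: eq_phi; exact: unpsi_xcoord.
Qed.

Lemma Psi_bij : bijective (Psi m0).
Proof. exact: Bijective (inj_can_sym unpsiK Psi_inj) unpsiK. Qed.

Lemma Psi_smallest (lam : pal_part (2 * m + 1)) : smallest (Psi m0 lam) = smallest lam.
Proof. exact: xcoord_smallest (Psi_xcoord lam (leq0n m)). Qed.

Lemma Psi_gaps (lam : pal_part (2 * m + 1)) h : size h = m.-1 ->
  (forall i, i < m.-1 -> nth 0 h i = nth 0 (gaps lam) i) ->
  gaps (Psi m0 lam) = h ++ nth 0 (gaps lam) m.-1 :: rev h.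
Proof.
move=> zh H; apply: (@palindrome_eq _ 0); rewrite ?rev_gaps //.
- by rewrite rev_cat rev_cons revK cat_rcons.
- by rewrite size_gaps_pal size_cat /= size_rev zh; lia.
move=> i; rewrite size_gaps_pal => Hi.
have im : i < m by lia.
rewrite -/(xcoord _ i.+1) Psi_xcoord //= nth_cat zh.
case: ltnP => [/H //|Hm]; have -> : i = m.-1 by lia.
by rewrite subnn.
Qed.

End Psi.

Lemma nth_scanl_addn a g i : i <= size g ->
  nth 0 (a :: scanl addn a g) i = a + sumn (take i g).
Proof.
elim: g a i => [|b g IH] a [|i] //= Hi; rewrite ?addn0 //.
by rewrite addnA -IH.
Qed.

(** The sum of the first n - i entries of a palindrome of length n is the sum
    of its last n - i entries, which completes that of its first i. *)
Lemma sumn_take_palindrome (g : seq nat) i : rev g = g ->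
  sumn (take i g) + sumn (take (size g - i) g) = sumn g.
Proof.
move=> pg; rewrite -[sumn (take (_ - _) g)]sumn_rev -drop_rev pg.
by rewrite -sumn_cat cat_take_drop.
Qed.

Lemma double_sumn r (l : pal_part r) : 0 < r ->
  2 * sumn l = r * (2 * smallest l + sumn (gaps l)).
Proof.
move=> r0; set c := 2 * _ + _.
have N i : i < r -> nth 0 l i = smallest l + sumn (take i (gaps l)).
  by move=> ir; rewrite {1}(pal_scanl l r0) nth_scanl_addn // size_gaps_pal; lia.
have E : sumn l = \sum_(i < r) nth 0 l i.
  by rewrite sumnE (big_nth 0) size_pal big_mkord.
rewrite mul2n -addnn {2}E (reindex_inj rev_ord_inj) E -big_split /=.
rewrite (eq_bigr (fun=> c)) => [|i _]; first by rewrite sum_nat_const card_ord.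
have -> : r - i.+1 = size (gaps l) - i by rewrite size_gaps_pal; lia.
rewrite !N ?ltn_ord //; last by rewrite size_gaps_pal; lia.
by have := sumn_take_palindrome i (rev_gaps l); rewrite /c; lia.
Qed.

Theorem corollary12 (m : nat) (m0 : 0 < m) :
  bijective (Psi m0) /\
  (forall (lam : pal_part (2 * m + 1)) (s : nat) (d : nat -> nat),
     smallest lam = s ->
     gaps lam = [seq d i | i <- iota 1 m] ++ rev [seq d i | i <- iota 1 m] ->
     let T := s + \sum_(1 <= i < m.+1) d i in
     [/\ smallest (Psi m0 lam) = s,
         gaps (Psi m0 lam) =
           [seq d i | i <- iota 1 m.-1] ++ d m :: rev [seq d i | i <- iota 1 m.-1],
         sumn lam = (2 * m + 1) * T
       & sumn (Psi m0 lam) = m * (2 * T - d m)]).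
Proof.
split; first exact: Psi_bij.
move=> lam s d Hs Hg T.
have D n : sumn [seq d i | i <- iota 1 n] = \sum_(1 <= i < n.+1) d i.
  by rewrite sumnE big_map /index_iota subn1.
have nthd n i : i < n -> nth 0 [seq d i | i <- iota 1 n] i = d i.+1.
  by move=> Hi; rewrite (nth_map 0) ?size_iota // nth_iota.
have nthg i : i < m -> nth 0 (gaps lam) i = d i.+1.
  by move=> im; rewrite Hg nth_cat size_map size_iota im nthd.
have S : smallest (Psi m0 lam) = s by rewrite Psi_smallest.
have G : gaps (Psi m0 lam) =
    [seq d i | i <- iota 1 m.-1] ++ d m :: rev [seq d i | i <- iota 1 m.-1].
  rewrite (@Psi_gaps m m0 lam [seq d i | i <- iota 1 m.-1]) ?size_map ?size_iota //.
    by rewrite nthg ?prednK.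
  by move=> i Hi; rewrite nthd // nthg //; lia.
have Dm : \sum_(1 <= i < m.+1) d i = \sum_(1 <= i < m.-1.+1) d i + d m.
  by rewrite big_nat_recr //= prednK.
split=> //.
- have odd_gt0 : 0 < 2 * m + 1 by lia.
  have := double_sumn lam odd_gt0.
  by rewrite Hs Hg sumn_cat sumn_rev D /T; nia.
- have even_gt0 : 0 < 2 * m by lia.
  have := double_sumn (Psi m0 lam) even_gt0.
  rewrite S G sumn_cat /= sumn_rev D /T Dm.
  have -> : 2 * (s + (\sum_(1 <= i < m.-1.+1) d i + d m)) - d m =
            2 * s + 2 * \sum_(1 <= i < m.-1.+1) d i + d m by lia.
  nia.
Qed.
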